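(* Let $n \ge 2$ be an integer and let $p$ be a positive integer. Then there exists an $n$-dimensional convex rational polytope $\mathcal{P} \subset \mathbb{R}^{n}$ whose period sequence is $(1, p, 1, \dotsc, 1)$, i.e. $p_1 = p$ and $p_i = 1$ for all $i \in \{0, 2, 3, \dotsc, n\}$.
   Context: A convex rational polytope is the convex hull of finitely many points of $\mathbb{Q}^n$. By Ehrhart's theorem, for such a polytope $\mathcal{P}$ there are functions $c_{\mathcal{P},i}\colon \mathbb{Z}\to\mathbb{Q}$ ($0 \le i \le n$), each periodic with some finite period, such that $|k\mathcal{P}\cap\mathbb{Z}^n| = \sum_{i=0}^n c_{\mathcal{P},i}(k)k^i$ for all integers $k\ge 1$. The period sequence of $\mathcal{P}$ is $(p_0,p_1,\dotsc,p_n)$, where $p_i$ is the minimum period of $c_{\mathcal{P},i}$. *)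

(* Defs.v *)
From mathcomp Require Export all_boot all_order all_algebra.
From mathcomp Require Export all_classical reals convex trigo.

Set Implicit Arguments.
Unset Strict Implicit.
Unset Printing Implicit Defensive.

Import Order.TTheory GRing.Theory Num.Theory.
Local Open Scope classical_set_scope.
Local Open Scope card_scope.
Local Open Scope ring_scope.

Definition convex_hull (R : realType) (n : nat) (A : set 'rV[R]_n) :
    set 'rV[R]_n :=
  smallest (@convex_set R 'rV[R]_n) A.

Definition rational_polytope (R : realType) (n : nat) (P : set 'rV[R]_n) :=
  exists V : seq 'rV[rat]_n,
    P = convex_hull [set map_mx ratr v | v in [set` V]].

Definition affinely_independent (R : realType) (n d : nat)
    (x : 'I_d.+1 -> 'rV[R]_n) :=
  row_free (\matrix_(i < d) (x (lift ord0 i) - x ord0)).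

(* A has dimension d: the largest affinely independent families of points of A
   have d + 1 members. *)
Definition has_dimension (R : realType) (n : nat) (A : set 'rV[R]_n)
    (d : nat) :=
  (exists2 x : 'I_d.+1 -> 'rV[R]_n,
     forall i, A (x i) & affinely_independent x) /\
  (forall (e : nat) (x : 'I_e.+1 -> 'rV[R]_n),
     (forall i, A (x i)) -> affinely_independent x -> (e <= d)%N).

Definition dilate (R : realType) (n : nat) (k : nat) (P : set 'rV[R]_n) :
    set 'rV[R]_n :=
  [set k%:R *: x | x in P].

Definition integer_lattice (R : realType) (n : nat) : set 'rV[R]_n :=
  range (fun z : 'rV[int]_n => map_mx intr z).

Definition minimum_period (f : int -> rat) (q : nat) :=
  [/\ (0 < q)%N, periodic f q%:Z &
      forall q' : nat, (0 < q')%N -> periodic f q'%:Z -> (q <= q')%N].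

(* c is the family of coefficient functions of the Ehrhart quasi-polynomial of
   P; the two conditions determine c uniquely. *)
Definition ehrhart_coefficients (R : realType) (n : nat) (P : set 'rV[R]_n)
    (c : 'I_n.+1 -> int -> rat) :=
  (forall i, exists2 q : nat, (0 < q)%N & periodic (c i) q%:Z) /\
  (forall k : nat, (0 < k)%N ->
     exists2 m : nat, dilate k P `&` @integer_lattice R n #= `I_m &
       m%:R = \sum_(i < n.+1) c i k%:Z * k%:R ^+ i :> rat).

Definition has_period_sequence (R : realType) (n : nat) (P : set 'rV[R]_n)
    (s : 'I_n.+1 -> nat) :=
  exists2 c : 'I_n.+1 -> int -> rat,
    ehrhart_coefficients P c & forall i, minimum_period (c i) (s i).

(* Main.v *)
(** Write a point of [R^n] as [(x, w_1, ..., w_(n-1))], give the last [w] weight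
    [p] and the others weight [1], and let [S] be the weighted sum of the [w_j].
    The polytope is
    [{w >= 0, S <= (2p-1) x, S <= 2p-1, S <= 2p+1 - x}],
    whose only non-integral vertices are the ends [x = 1, 2] of one edge.
    The number [F(N)] of integer points with [w >= 0] and [S <= N] has the form
    [Q(N) + psi(N)] with [Q] a polynomial and [psi] periodic of minimal period
    [p].  Slicing the [k]-th dilate by [x] gives the count
    [sum_(x < k) F((2p-1)x) + (k+1) F((2p-1)k) + sum_(N < (2p-1)k) F(N)].
    From [k] to [k+1], the terms [psi((2p-1)(k+1))] and [psi(N)] for
    [(2p-1)k <= N < (2p-1)(k+1)] that are added range over [2p] consecutive
    arguments, i.e. two full periods; hence the [psi]-part of the count is an
    affine function of [k] plus [k psi((2p-1)k)], which only affects the linear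
    coefficient. *)
Require Import Defs.
From mathcomp Require Import zify ring lra.
From mathcomp Require Import interval_inference.

Set Implicit Arguments.
Unset Strict Implicit.
Unset Printing Implicit Defensive.

Import Order.TTheory GRing.Theory Num.Theory.
Local Open Scope classical_set_scope.
Local Open Scope card_scope.
Local Open Scope ring_scope.

(** * Sums of polynomials and of periodic functions *)

Lemma exprD1X (R : nzRingType) (d : nat) :
  (1 + 'X : {poly R}) ^+ d = \poly_(i < d.+1) 'C(d, i)%:R.
Proof.
rewrite exprDn_comm ?poly_def; last exact: commr_polyX.
by apply: eq_bigr => i _; rewrite expr1n mul1r scaler_nat.
Qed.

(** Induction on the degree bound: subtracting a multiple of the telescoping difference
    [(1 + 'X) ^+ d.+1 - 'X ^+ d.+1] removes the top coefficient of [q]. *)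
Lemma sum_horner (d : nat) (q : {poly rat}) : (size q <= d)%N ->
  exists2 s : {poly rat},
    (size s <= d.+1)%N & forall N, \sum_(i < N) q.[i%:R] = s.[N%:R].
Proof.
elim: d q => [|d IHd] q sq.
  exists 0; first by rewrite size_poly0.
  move: sq; rewrite leqn0 size_poly_eq0 => /eqP-> N.
  by rewrite horner0 big1 // => i _; rewrite horner0.
pose a := q`_d / d.+1%:R; pose t : {poly rat} := a *: 'X ^+ d.+1.
pose q1 := q - a *: ((1 + 'X) ^+ d.+1 - 'X ^+ d.+1).
have sq1 : (size q1 <= d)%N.
  apply/leq_sizeP => j; rewrite leq_eqVlt => /orP[/eqP<-|dj].
    rewrite !coefE exprD1X coef_poly leqnSn.
    rewrite (ltn_eqF (ltnSn d)) subr0 binSn /a.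
    by rewrite mulfVK ?pnatr_eq0 // subrr.
  rewrite !coefE exprD1X coef_poly ltnS (leq_sizeP _ _ sq) // sub0r.
  case: (ltngtP j d.+1) dj => // [_ _|-> _]; first by rewrite subrr mulr0 oppr0.
  by rewrite binn subrr mulr0 oppr0.
have [s ss sE] := IHd _ sq1.
exists (s + t).
  rewrite (leq_trans (size_polyD _ _)) // geq_max (leq_trans ss) //=.
  by rewrite (leq_trans (size_scale_leq _ _)) // size_polyXn.
move=> N; rewrite hornerD -sE.
elim: N => [|N IHN].
  by rewrite !big_ord0 /t hornerZ hornerXn exprS mul0r mulr0 add0r.
rewrite !big_ord_recr /= IHN /q1 /t !hornerE /= .
by rewrite -natr1 [N%:R + 1]addrC; ring.
Qed.

(** Moving the window by one drops [psi m] and gains [psi (m + p)], which are equal. *)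
Lemma sum_periodic_window (psi : nat -> rat) (p m : nat) :
  (forall N, psi (N + p)%N = psi N) ->
  \sum_(i < p) psi (m + i)%N = \sum_(i < p) psi i.
Proof.
move=> psiP; elim: m => // m <-.
case: p psiP => [|p] psiP; first by rewrite !big_ord0.
rewrite big_ord_recr big_ord_recl /= addrC addn0 addSnnS psiP; congr (_ + _).
by apply: eq_bigr => i _; rewrite addSnnS.
Qed.

(** * Quasi-polynomials for the counts *)

(* simplexCount p r N is the number of solutions in nat of
   z_1 + ... + z_r + p * h <= N. *)
Fixpoint simplexCount (p r N : nat) : nat :=
  if r is r'.+1 then \sum_(i < N.+1) simplexCount p r' i else (N %/ p).+1.

(** For [r = 0], [N %/ p] is [N / p] minus a sawtooth of period [p]. Each summation turns the mean
    of [psi] into a polynomial term and leaves the partial sums of [psi - mu]; differences of these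
    give [psi] back, so the minimal period survives. *)
Lemma simplexCount_quasipoly (p r : nat) : (0 < p)%N ->
  exists (Q : {poly rat}) (psi : nat -> rat),
  [/\ (size Q <= r.+2)%N, forall N, psi (N + p)%N = psi N,
      forall N, (simplexCount p r N)%:R = Q.[N%:R] + psi N &
      forall q, (0 < q)%N -> (forall N, psi (N + q)%N = psi N) -> (p <= q)%N].
Proof.
move=> p0; have pN0 : p%:R != 0 :> rat by rewrite pnatr_eq0 -lt0n.
elim: r => [|r [Q [psi [sQ psiP FE psimin]]]].
  exists (p%:R^-1 *: 'X), (fun N => 1 - (N %% p)%:R / p%:R); split.
  - by rewrite (leq_trans (size_scale_leq _ _)) // size_polyX.
  - by move=> N; rewrite modnDr.
  - move=> N; rewrite !hornerE /= {2}(divn_eq N p) natrD natrM -natr1.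
    by field.
  - move=> q q0 /(_ 0%N); rewrite add0n mod0n mul0r.
    move=> /(congr1 (fun x => 1 - x)); rewrite !subKr => /eqP.
    rewrite mulf_eq0 invr_eq0 (negPf pN0) orbF pnatr_eq0 => qp.
    exact: dvdn_leq.
pose mu := (\sum_(i < p) psi i) / p%:R; pose G N := \sum_(i < N) (psi i - mu).
have GP N : G (N + p)%N = G N.
  rewrite /G big_split_ord /= -[RHS]addr0; congr (_ + _).
  rewrite sumrB (sum_periodic_window N psiP) sumr_const card_ord -mulr_natr.
  by rewrite /mu mulfVK // subrr.
have [s ss sE] := sum_horner sQ.
exists (s \Po (1 + 'X) + mu *: (1 + 'X)), (fun N => G N.+1); split.
- rewrite (leq_trans (size_polyD _ _)) // geq_max; apply/andP; split.
    rewrite (leq_trans (size_comp_poly_leq _ _)) //.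
    by rewrite addrC -[1]/(1%:P) size_XaddC muln1; case: (size s) ss.
  by rewrite (leq_trans (size_scale_leq _ _)) // addrC -[1]/(1%:P) size_XaddC.
- by move=> N; rewrite -addSn GP.
- move=> N; rewrite /= natr_sum hornerD horner_comp !hornerE /= !nat1r.
  rewrite -sE /G sumrB sumr_const card_ord -mulr_natr.
  rewrite (eq_bigr (fun i : 'I_N.+1 => Q.[i%:R] + psi i)) => [|i _]; last exact: FE.
  by rewrite big_split /=; ring.
- move=> q q0 Gq; apply: psimin => // N.
  have step M : psi M.+1 = G M.+2 - G M.+1 + mu.
    by rewrite {1}/G big_ord_recr /= -/(G M.+1); ring.
  (* The hypothesis on [q] reaches [G] only at positive arguments; shifting by [p] makes both
     arguments of [psi] successors, as [step] demands. *)
  rewrite -psiP -(psiP N) addnAC -(prednK p0) addnS addSn !step.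
  by rewrite Gq -[(N + _ + q).+1]addSn Gq.
Qed.

(* The three terms are the slices of the k-th dilate with x < k, k <= x <= 2k and
   x > 2k; in the last range the bound (2p+1)k - x takes each value N once. *)
Definition trapezoidCount (p r k : nat) : nat :=
  \sum_(x < k) simplexCount p r ((2 * p).-1 * x) +
  k.+1 * simplexCount p r ((2 * p).-1 * k) +
  \sum_(N < (2 * p).-1 * k) simplexCount p r N.

Lemma sum_periodic_trapezoid (psi : nat -> rat) (p k : nat) : (0 < p)%N ->
  (forall N, psi (N + p)%N = psi N) ->
  \sum_(x < k.+1) psi ((2 * p).-1 * x)%N + \sum_(N < (2 * p).-1 * k) psi N =
  psi 0%N + (\sum_(i < p) psi i) *+ 2 *+ k.
Proof.
move=> p0 psiP; elim: k => [|k IHk].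
  by rewrite big_ord_recr !big_ord0 muln0 big_ord0 /= mulr0n !addr0 add0r.
rewrite big_ord_recr mulnSr big_split_ord /= mulrSr !addrA -IHk -!addrA.
congr (_ + _); rewrite addrCA; congr (_ + _).
(* The new term of the first sum directly follows the [2p-1] new terms of the second. *)
rewrite addrC -(big_ord_recr _ (fun i : 'I__ => psi ((2 * p).-1 * k + i)%N)) /=.
rewrite prednK ?muln_gt0 // mul2n -addnn big_split_ord /=.
rewrite sum_periodic_window //; congr (_ + _).
by under eq_bigr do rewrite addnA; rewrite sum_periodic_window.
Qed.

Lemma size_comp_scaleX (s : {poly rat}) (a : rat) (d : nat) :
  (size s <= d)%N -> (size (s \Po (a *: 'X)) <= d)%N.
Proof.
move=> sd; apply/leq_sizeP => j dj; rewrite coef_comp_poly big1 // => i _.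
rewrite exprZn coefZ coefXn (_ : (j == i :> nat) = false) ?mulr0 //.
by apply/negbTE; rewrite neq_ltn (leq_trans (ltn_ord i)) ?orbT // (leq_trans sd).
Qed.

(** With [a = 2p-1], one of the [k.+1] copies of [psi (a * k)] completes the sum of [psi] over
    [x < k], so that [sum_periodic_trapezoid] applies; the other [k] copies form the non-polynomial
    term. *)
Lemma trapezoidCount_quasipoly (p r : nat) : (0 < p)%N ->
  exists (Q : {poly rat}) (psi : nat -> rat),
  [/\ (size Q <= r.+3)%N, forall N, psi (N + p)%N = psi N,
      forall k, (trapezoidCount p r k)%:R =
        Q.[k%:R] + psi ((2 * p).-1 * k)%N * k%:R &
      forall q, (0 < q)%N -> (forall N, psi (N + q)%N = psi N) -> (p <= q)%N].
Proof.
move=> p0; have [Q [psi [sQ psiP FE psimin]]] := simplexCount_quasipoly r p0.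
set a := (2 * p).-1; have [s ss sE] := sum_horner sQ.
pose Qa := Q \Po (a%:R *: 'X); have sQa : (size Qa <= r.+2)%N.
  exact: size_comp_scaleX.
have [t ts tE] := sum_horner sQa.
pose A := (\sum_(i < p) psi i) *+ 2.
exists (t + (1 + 'X) * Qa + (s \Po (a%:R *: 'X)) + ((psi 0%N)%:P + A *: 'X)), psi.
split=> // [|k].
  rewrite (leq_trans (size_polyD _ _)) // geq_max; apply/andP; split.
    rewrite (leq_trans (size_polyD _ _)) // geq_max size_comp_scaleX // andbT.
    rewrite (leq_trans (size_polyD _ _)) // geq_max ts /=.
    rewrite (leq_trans (size_polyMleq _ _)) //.
    by rewrite addrC -[1]/(1%:P) size_XaddC.
  rewrite (leq_trans (size_polyD _ _)) // geq_max.
  rewrite (leq_trans (size_polyC_leq1 _)) //=.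
  by rewrite (leq_trans (size_scale_leq _ _)) // size_polyX.
have QaE (i : nat) : Qa.[i%:R] = Q.[(a * i)%:R].
  by rewrite /Qa horner_comp !hornerE /= natrM.
rewrite !hornerD hornerM QaE horner_comp !hornerE /= -natrM -sE -tE.
have -> : A * k%:R = \sum_(x < k.+1) psi (a * x)%N + \sum_(N < a * k) psi N
    - psi 0%N.
  by rewrite sum_periodic_trapezoid // addrC addKr mulr_natr.
rewrite /trapezoidCount -/a 2!natrD [(k.+1 * _)%:R]natrM !natr_sum FE -natr1.
rewrite (eq_bigr (fun x : 'I_k => Qa.[x%:R] + psi (a * x)%N)) => [|x _]; last first.
  by rewrite FE QaE.
rewrite [\sum_(_ < a * k) _](eq_bigr (fun N : 'I__ => Q.[N%:R] + psi N)) => [|N _].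
  by rewrite !big_split big_ord_recr natrM /=; ring.
by rewrite FE.
Qed.

(** * Counting vectors with bounded coordinates *)

Definition fcons (X : finType) (r : nat) (a : X) (v : {ffun 'I_r -> X}) :
  {ffun 'I_r.+1 -> X} := [ffun j => oapp v a (unlift ord0 j)].

Lemma fcons0 (X : finType) (r : nat) (a : X) (v : {ffun 'I_r -> X}) :
  fcons a v ord0 = a.
Proof. by rewrite ffunE unlift_none. Qed.

Lemma fconsS (X : finType) (r : nat) (a : X) (v : {ffun 'I_r -> X}) j :
  fcons a v (lift ord0 j) = v j.
Proof. by rewrite ffunE liftK. Qed.

Lemma big_ffun_recl (X : finType) (r : nat)
    (G : {ffun 'I_r.+1 -> X} -> nat) :
  (\sum_w G w = \sum_a \sum_v G (fcons a v))%N.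
Proof.
rewrite pair_big (reindex (fun av : X * _ => fcons av.1 av.2)) //=.
exists (fun w : {ffun 'I_r.+1 -> X} => (w ord0, [ffun j => w (lift ord0 j)])).
  move=> [a v] _ /=; rewrite fcons0; congr (_, _).
  by apply/ffunP => j; rewrite !ffunE liftK.
move=> w _ /=; apply/ffunP => j; rewrite ffunE.
by case: unliftP => [i|] -> //=; rewrite ffunE.
Qed.

(** The weight [p] sits on the last coordinate so that peeling off the first one leaves weights of
    the same form, with [p] alone as base case. *)
Definition wgt (p r : nat) (j : 'I_r.+1) : nat := if j == ord_max then p else 1.

(** The box bound [M] excludes no solution because all weights are at least 1. It is separate from
    [N] so that the induction can lower [N] to [N - a] inside the same box. *)
Lemma simplexCountE (p r M N : nat) : (0 < p)%N -> (N <= M)%N ->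
  (\sum_(w : {ffun 'I_r.+1 -> 'I_M.+1}) (\sum_j wgt p j * w j <= N)%N)%N =
  simplexCount p r N.
Proof.
move=> p0; elim: r N => [|r IHr] N NM.
  rewrite big_ffun_recl /=.
  transitivity (\sum_(a < M.+1) (p * a <= N)%N)%N.
    apply: eq_bigr => a _; under eq_bigr => v _.
      rewrite big_ord_recl big_ord0 fcons0 /wgt addn0.
      by rewrite (_ : ord0 == ord_max) //=; over.
    by rewrite sum_nat_const card_ffun !card_ord expn0 mul1n.
  have NpM : ((N %/ p).+1 <= M.+1)%N by rewrite ltnS (leq_trans (leq_div _ _)).
  rewrite -(subnKC NpM) big_split_ord /= [X in (_ + X)%N]big1 => [|i _].
    rewrite addn0 -[RHS]card_ord -sum1_card; apply: eq_bigr => i _.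
    by rewrite mulnC -leq_divRL // -ltnS ltn_ord.
  apply/eqP; rewrite eqb0 -ltnNge mulnC -ltn_divLR //.
  by rewrite ltn_addr.
rewrite big_ffun_recl /=.
have wgtS (v : {ffun 'I_r.+1 -> 'I_M.+1}) (a : 'I_M.+1) :
    (\sum_j wgt p j * fcons a v j = a + \sum_j wgt p j * v j)%N.
  rewrite big_ord_recl fcons0 {1}/wgt (_ : ord0 == ord_max = false) // mul1n.
  congr (_ + _)%N; apply: eq_bigr => j _; rewrite fconsS /wgt.
  by rewrite -!val_eqE /= /bump leq0n add1n eqSS.
transitivity (\sum_(a < M.+1 | (a < N.+1)%N) simplexCount p r (N - a))%N.
  rewrite [RHS]big_mkcond; apply: eq_bigr => a _; under eq_bigr do rewrite wgtS.
  rewrite ltnS; case: leqP => aN.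
    rewrite -IHr ?(leq_trans (leq_subr _ _)) //; apply: eq_bigr => v _.
    by rewrite leq_subRL.
  rewrite big1 // => v _; apply/eqP; rewrite eqb0 -ltnNge.
  exact: leq_trans aN (leq_addr _ _).
rewrite -(big_ord_widen _ (fun a => simplexCount p r (N - a))) //.
rewrite (reindex_inj rev_ord_inj) /=; apply: eq_bigr => i _.
by rewrite subSS subKn // -ltnS.
Qed.

Definition in_trapezoid (p r k M : nat) (y : {ffun 'I_r.+2 -> 'I_M.+1}) :=
  let s := (\sum_j wgt p j * y (lift ord0 j))%N in
  [&& s <= (2 * p).-1 * y ord0, s <= (2 * p).-1 * k
    & s + y ord0 <= (2 * p).+1 * k]%N.

(** In the slice [x = y ord0] the weighted sum is bounded by the least of three numbers; which one
    it is depends on whether [x < k], [k <= x <= 2k] or [2k < x]. *)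
Lemma trapezoidCountE (p r k : nat) : (0 < p)%N ->
  #|[pred y | @in_trapezoid p r k ((2 * p).+1 * k) y]| = trapezoidCount p r k.
Proof.
move=> p0; set a := (2 * p).-1; set M := ((2 * p).+1 * k)%N.
rewrite -sum1_card big_mkcond /= big_ffun_recl.
transitivity (\sum_(x < M.+1)
    simplexCount p r (minn (minn (a * x) (a * k)) (M - x)))%N.
  apply: eq_bigr => x _; have xM : (x <= M)%N by rewrite -ltnS.
  rewrite -(@simplexCountE p r M) ?geq_min ?leq_subr ?orbT //.
  apply: eq_bigr => w _; rewrite inE /in_trapezoid fcons0 -/a -/M.
  under eq_bigr do rewrite fconsS.
  by rewrite !leq_min leq_subRL // addnC -andbA; case: ifP.
have ->: M.+1 = (k + (k.+1 + a * k))%N by rewrite /M /a; nia.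
rewrite !big_split_ord /= /trapezoidCount -/a addnA; congr (_ + _ + _)%N.
- apply: eq_bigr => x _; congr simplexCount.
  have xk := ltn_ord x; rewrite /M /a; nia.
- rewrite (eq_bigr (fun=> simplexCount p r (a * k))) => [|x _].
    by rewrite sum_nat_const card_ord.
  congr simplexCount; have xk := ltn_ord x; rewrite /M /a; nia.
(* Reversal makes the bound [M - x] run upwards from 0. *)
rewrite (reindex_inj rev_ord_inj) /=; apply: eq_bigr => x _.
congr simplexCount; have xk := ltn_ord x; rewrite /M; move: xk; rewrite /a; nia.
Qed.

(** * Convex combinations and finite cardinalities *)

Lemma convex_setE (R : realType) (n : nat) (A : set 'rV[R]_n) :
  @convex_set R 'rV[R]_n A <->
  forall (x y : 'rV[R]_n) (t : R), 0 <= t <= 1 -> A x -> A y ->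
    A (t *: x + (1 - t) *: y).
Proof.
split=> [cA x y t t01 Ax Ay|cA x y t].
  have /set_mem := cA x y (Itv01 (proj1 (andP t01)) (proj2 (andP t01)))
    (mem_set Ax) (mem_set Ay).
  by [].
rewrite !inE => Ax Ay.
apply: (cA x y t%:num) => //.
by rewrite ge0 le1.
Qed.

(** Induction: the terms after the first, of total weight [s], are merged into one point by dividing
    by [s]; if [s = 0] they all vanish. *)
Lemma convex_sum (R : realType) (n : nat) (A : set 'rV[R]_n) (d : nat)
    (l : 'I_d -> R) (v : 'I_d -> 'rV[R]_n) :
  @convex_set R 'rV[R]_n A -> (forall i, 0 <= l i) -> \sum_i l i = 1 ->
  (forall i, A (v i)) -> A (\sum_i l i *: v i).
Proof.
move=> /convex_setE cA; elim: d l v => [|d IHd] l v l0 l1 Av.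
  by move: l1; rewrite big_ord0 => /eqP; rewrite eq_sym oner_eq0.
move: l1; rewrite !big_ord_recl; set s := \sum_(_ < d) l _ => l1.
have s0 : 0 <= s by apply: sumr_ge0.
have [sE0|sN0] := eqVneq s 0.
  move: l1; rewrite sE0 addr0 => ->; rewrite scale1r big1 ?addr0 // => i _.
  move/eqP: sE0; rewrite psumr_eq0 => [/allP/(_ i)|//].
  by rewrite mem_index_enum => /(_ isT)/eqP->; rewrite scale0r.
rewrite (_ : \sum_(_ < d) _ *: _ = (1 - l ord0) *:
    \sum_(i < d) (l (lift ord0 i) / s) *: v (lift ord0 i)).
  apply: cA => //; first by rewrite l0 -l1 lerDl.
  apply: IHd => // [i|]; first by rewrite divr_ge0.
  by rewrite -mulr_suml divff.
rewrite -l1 addrAC subrr add0r scaler_sumr; apply: eq_bigr => i _.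
by rewrite scalerA mulrC mulfVK.
Qed.

Lemma card_finpred (T : finType) (P : pred T) : [set` P] #= `I_#|P|.
Proof.
have inj : {in [set` P] &, injective (index^~ (enum P))}.
  move=> x y; rewrite !inE => Px Py; apply: index_inj; rewrite ?mem_enum //.
rewrite card_eq_sym (_ : `I_#|P| = (index^~ (enum P)) @` [set` P]).
  exact: inj_card_eq.
apply/seteqP; split => [i /= iP|_ [x Px <-]]; last first.
  by rewrite /= cardE index_mem mem_enum.
have [x0 _] : exists x0, x0 \in P by apply/card_gt0P/(leq_ltn_trans _ iP).
exists (nth x0 (enum P) i); last by rewrite index_uniq ?enum_uniq // -cardE.
by rewrite /= -mem_enum mem_nth // -cardE.
Qed.

(** * The polytope, its dilates and its lattice points *)

Definition wsum (R : realType) (p r : nat) (v : 'rV[R]_r.+2) : R :=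
  \sum_j (wgt p j)%:R * v 0 (lift ord0 j).

(** [t] is the dilation factor: the polytope is the case [t = 1], and its [k]-th dilate is the case
    [t = k]. *)
Definition trapezoid (R : realType) (p r : nat) (t : R) : set 'rV[R]_r.+2 :=
  [set v : 'rV[R]_r.+2 | [/\ forall j, 0 <= v 0 (lift ord0 j),
     wsum p v <= (2 * p).-1%:R * v 0 ord0,
     wsum p v <= (2 * p).-1%:R * t &
     wsum p v + v 0 ord0 <= (2 * p).+1%:R * t]].

Lemma wsumD (R : realType) (p r : nat) (a b : R) (u v : 'rV[R]_r.+2) :
  wsum p (a *: u + b *: v) = a * wsum p u + b * wsum p v.
Proof.
rewrite /wsum !mulr_sumr -big_split; apply: eq_bigr => j _ /=.
by rewrite !mxE; ring.
Qed.

Lemma wsumZ (R : realType) (p r : nat) (a : R) (u : 'rV[R]_r.+2) :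
  wsum p (a *: u) = a * wsum p u.
Proof. by rewrite -[a *: u]addr0 -(scaler0 _ 0) wsumD mul0r addr0. Qed.

Lemma trapezoid_convex (R : realType) (p r : nat) (t : R) :
  @convex_set R 'rV[R]_r.+2 (trapezoid p t).
Proof.
apply/convex_setE => x y s /andP[s0 s1] [x1 x2 x3 x4] [y1 y2 y3 y4].
have s0' : 0 <= 1 - s by rewrite subr_ge0.
split; rewrite ?wsumD ?mxE.
- by move=> j; rewrite !mxE addr_ge0 // mulr_ge0.
- by have := lerD (ler_wpM2l s0 x2) (ler_wpM2l s0' y2); lra.
- by have := lerD (ler_wpM2l s0 x3) (ler_wpM2l s0' y3); lra.
- by have := lerD (ler_wpM2l s0 x4) (ler_wpM2l s0' y4); lra.
Qed.

Lemma dilate_trapezoid (R : realType) (p r k : nat) : (0 < k)%N ->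
  dilate k (@trapezoid R p r 1) = trapezoid p k%:R.
Proof.
move=> k0; have kR : 0 < k%:R :> R by rewrite ltr0n.
apply/seteqP; split => [_ [v [v1 v2 v3 v4] <-]|v [v1 v2 v3 v4]].
  split; rewrite ?wsumZ ?mxE.
  - by move=> j; rewrite mxE mulr_ge0 // ltW.
  - by rewrite mulrCA ler_pM2l.
  - by rewrite mulrC ler_pM2r // -[leRHS]mulr1.
  - by rewrite -mulrDr mulrC ler_pM2r // -[leRHS]mulr1.
exists (k%:R^-1 *: v); last by rewrite scalerA divff ?gt_eqF // scale1r.
split; rewrite ?wsumZ ?mxE.
- by move=> j; rewrite mxE mulr_ge0 // invr_ge0 ltW.
- by rewrite mulrCA ler_pM2l // invr_gt0.
- by rewrite mulrC ler_pdivrMr // mulr1.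
- by rewrite -mulrDr mulrC ler_pdivrMr // mulr1.
Qed.

Lemma wgt_gt0 (p r : nat) (j : 'I_r.+1) : (0 < p)%N -> (0 < wgt p j)%N.
Proof. by rewrite /wgt; case: eqP. Qed.

Definition nat_point (R : realType) (r M : nat) (y : {ffun 'I_r.+2 -> 'I_M.+1}) :
  'rV[R]_r.+2 := \row_j (y j)%:R.

Lemma nat_point_inj (R : realType) (r M : nat) : injective (@nat_point R r M).
Proof.
move=> y1 y2 /rowP y12; apply/ffunP => j; apply/val_inj/eqP.
by move: (y12 j); rewrite !mxE => /eqP; rewrite eqr_nat.
Qed.

Lemma trapezoid_nat_point (R : realType) (p r k M : nat)
    (y : {ffun 'I_r.+2 -> 'I_M.+1}) :
  trapezoid p k%:R (nat_point R y) <-> in_trapezoid p k y.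
Proof.
have sE : wsum p (nat_point R y) = (\sum_j wgt p j * y (lift ord0 j))%N%:R.
  by rewrite /wsum natr_sum; apply: eq_bigr => j _; rewrite mxE natrM.
rewrite /in_trapezoid -!(ler_nat R) natrD !natrM -sE; split.
  by case=> _; rewrite mxE => -> -> ->.
move=> /and3P[? ? ?]; split=> [j|||]; rewrite ?mxE //.
Qed.

(** All coordinates lie between 0 and [M]: the first is nonnegative because [2p-1] times it bounds
    [wsum], which is nonnegative, and each coordinate is at most [wsum] plus the first one. *)
Lemma trapezoid_lattice (R : realType) (p r k : nat) : (0 < p)%N ->
  trapezoid p k%:R `&` @integer_lattice R r.+2 =
  (@nat_point R r ((2 * p).+1 * k)) @` [set` [pred y | in_trapezoid p k y]].
Proof.
move=> p0; apply/seteqP; split => [v [vP [z _ zE]]|_ [y /= yP <-]]; last first.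
  split; first exact/trapezoid_nat_point.
  by exists (\row_j (y j)%:Z) => //; apply/rowP => j; rewrite !mxE.
set M := ((2 * p).+1 * k)%N.
case: (vP) => v1 v2 v3 v4.
have a0 : 0 < (2 * p).-1%:R :> R by rewrite ltr0n; lia.
have s0 : 0 <= wsum p v by apply: sumr_ge0 => j _; rewrite mulr_ge0.
have x0 : 0 <= v 0 ord0 by rewrite -(pmulr_rge0 _ a0) (le_trans s0).
have v0 j : 0 <= v 0 j by case: (unliftP ord0 j) => [i|] ->.
have vM j : v 0 j <= M%:R.
  rewrite natrM; apply: le_trans v4.
  case: (unliftP ord0 j) => [i|] ->; last by rewrite lerDr.
  apply: ler_wpDr => //; rewrite /wsum (bigD1 i) //=; apply: ler_wpDr.
    by apply: sumr_ge0 => l _; rewrite mulr_ge0.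
  by rewrite ler_peMl // ler1n wgt_gt0.
have vE j : v 0 j = (absz (z 0 j))%:R.
  have := v0 j; rewrite -zE mxE ler0z => zj0.
  by rewrite natr_absz ger0_norm.
have zM j : (absz (z 0%R j) < M.+1)%N by rewrite ltnS -(ler_nat R) -vE.
have yE : nat_point R [ffun j => inord (absz (z 0 j)) : 'I_M.+1] = v.
  by apply/rowP => j; rewrite mxE ffunE inordK // -vE.
exists [ffun j => inord (absz (z 0 j))] => //=.
by apply/(@trapezoid_nat_point R); rewrite yE.
Qed.

(** * Dimension and vertices *)

(** Points of the plane spanned by axis [ord0] and one other axis. The scalars are general so as to
    serve both the rational vertices and their real images. *)
Definition spoke (K : nzRingType) (r : nat) (j : 'I_r.+1) (x y : K) : 'rV[K]_r.+2 :=
  x *: delta_mx 0 ord0 + y *: delta_mx 0 (lift ord0 j).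

Lemma spoke0 (K : nzRingType) (r : nat) (j : 'I_r.+1) (x y : K) :
  spoke j x y 0 ord0 = x.
Proof. by rewrite !mxE /= mulr1 mulr0 addr0. Qed.

Lemma spokeS (K : nzRingType) (r : nat) (i j : 'I_r.+1) (x y : K) :
  spoke j x y 0 (lift ord0 i) = y *+ (i == j).
Proof.
by rewrite !mxE /= mulr0 add0r (inj_eq lift_inj) mulr_natr.
Qed.

Lemma spoke_trapezoid (R : realType) (p r : nat) (j : 'I_r.+1) (x y t : R) :
  trapezoid p t (spoke j x y) <->
  [/\ 0 <= y, (wgt p j)%:R * y <= (2 * p).-1%:R * x,
     (wgt p j)%:R * y <= (2 * p).-1%:R * t &
     (wgt p j)%:R * y + x <= (2 * p).+1%:R * t].
Proof.
have sE : wsum p (spoke j x y) = (wgt p j)%:R * y.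
  rewrite /wsum (bigD1 j) //= spokeS eqxx big1 ?addr0 // => i /negPf ij.
  by rewrite spokeS ij mulr0.
rewrite /trapezoid /= sE spoke0; split=> [[/(_ j)]|[y0 ? ? ?]].
  by rewrite spokeS eqxx.
by split=> // i; rewrite spokeS mulrn_wge0.
Qed.

Lemma trapezoid_dimension (R : realType) (p r : nat) : (0 < p)%N ->
  has_dimension (@trapezoid R p r 1) r.+2.
Proof.
move=> p0; split; last first.
  by move=> e x _ /eqP <-; exact: rank_leq_col.
have a0 : 1 <= (2 * p).-1%:R :> R by rewrite ler1n; lia.
have aE : (2 * p).+1%:R = (2 * p).-1%:R + 2 :> R.
  by rewrite -natrD; congr _%:R; lia.
(* The default [0] at index [ord0] gives the base point [e_0]; the other points are [e_0 + e_j],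
   among them [2 e_0], so the differences form the identity matrix. *)
pose x (i : 'I_r.+3) : 'rV[R]_r.+2 := delta_mx 0 ord0 +
  oapp (fun j => delta_mx 0 j) 0 (unlift ord0 i).
exists x => [i|]; last first.
  rewrite /affinely_independent (_ : \matrix_i _ = 1%:M) ?row_free_unit ?unitmx1 //.
  apply/row_matrixP => i; rewrite rowK /x liftK unlift_none /= addr0 addrC addKr.
  by rewrite row1.
rewrite /x; case: unliftP => [j|] _ /=; last first.
  rewrite -[_ + 0](_ : spoke ord0 1 0 = _); last by rewrite /spoke scale1r scale0r.
  by apply/spoke_trapezoid; split; rewrite ?mulr0 ?aE //; lra.
case: (unliftP ord0 j) => [l|] ->.
  rewrite -[_ + _](_ : spoke l 1 1 = _); last by rewrite /spoke !scale1r.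
  have wa : (wgt p l)%:R <= (2 * p).-1%:R :> R.
    by rewrite ler_nat /wgt; case: ifP; lia.
  by apply/spoke_trapezoid; split; rewrite ?mulr1 ?aE //; lra.
rewrite -[_ + _](_ : spoke ord0 2 0 = _).
  by apply/spoke_trapezoid; split; rewrite ?mulr0 ?aE //; lra.
by rewrite /spoke scale0r addr0 -mulr2n -scaler_nat.
Qed.

(** The second entry is the weighted sum, not the coordinate [w_j]; thus one list serves all [j],
    and [trapezoid_vertices] divides by the weight. *)
Definition trapezoid_corners (p : nat) : seq (rat * rat) :=
  [:: (0, 0); (1, (2 * p).-1%:R); (2, (2 * p).-1%:R); ((2 * p).+1%:R, 0)].

Definition trapezoid_vertices (p r : nat) : seq 'rV[rat]_r.+2 :=
  [seq spoke j c.1 (c.2 / (wgt p j)%:R)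
     | j <- enum 'I_r.+1, c <- trapezoid_corners p].

(** Every point is a convex combination of spokes with the same [x] and the same weighted sum, which
    reduces the harder inclusion to planar trapezoids. *)
Lemma trapezoid_polytope (R : realType) (p r : nat) : (0 < p)%N ->
  rational_polytope (@trapezoid R p r 1).
Proof.
move=> p0; exists (trapezoid_vertices p r).
have a1 : 1 <= (2 * p).-1%:R :> R by rewrite ler1n; lia.
have aE : (2 * p).+1%:R = (2 * p).-1%:R + 2 :> R.
  by rewrite -natrD; congr _%:R; lia.
set a : R := (2 * p).-1%:R in a1 aE *.
have a0 : a != 0 by rewrite gt_eqF // (lt_le_trans ltr01).
have w0 (j : 'I_r.+1) : 0 < (wgt p j)%:R :> R by rewrite ltr0n wgt_gt0.
have wN0 (j : 'I_r.+1) : (wgt p j)%:R != 0 :> R by rewrite gt_eqF.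
have mapE (j : 'I_r.+1) (x y : rat) :
    map_mx (@ratr R) (spoke j x y) = spoke j (ratr x) (ratr y).
  by rewrite /spoke map_mxD !map_mxZ !map_delta_mx.
apply/seteqP; split; last first.
  apply: smallest_sub; first exact: trapezoid_convex.
  move=> _ [_ /allpairsP[[j c] [_ cV ->]] <-] /=.
  rewrite mapE; apply/spoke_trapezoid.
  rewrite fmorph_div rmorph_nat mulrCA divff // mulr1.
  rewrite -/a; move: cV; rewrite !inE /=.
  by move=> /or4P[] /eqP->; rewrite /= ?rmorph_nat ?rmorph0 ?rmorph1 -?/a ?aE; split;
    rewrite ?divr_ge0 ?(ltW (w0 _)) //; nra.
(* The hull is an intersection, so [C] is an arbitrary convex set containing the vertices. *)
move=> v [v1 v2 v3 v4] C [/= cC CV].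
have Cv j (c : rat * rat) : c \in trapezoid_corners p ->
    C (spoke j (ratr c.1) (ratr c.2 / (wgt p j)%:R)).
  move=> cV; apply: CV; exists (spoke j c.1 (c.2 / (wgt p j)%:R)).
    by apply/allpairsP; exists (j, c); rewrite mem_enum.
  by rewrite mapE fmorph_div rmorph_nat.
move/convex_setE: (cC) => cC2.
(* [spoke j x y] lies on a horizontal chord of the trapezoid in the plane of the
   axes [0] and [lift ord0 j], from [(u / a, u)] to [(2p + 1 - u, u)]. *)
have Cspoke j (x y : R) (u := (wgt p j)%:R * y) : 0 <= y -> u <= a * x -> u <= a ->
    u + x <= a + 2 -> C (spoke j x y).
  move=> y0 ux ua uxa.
  have u0 : 0 <= u by rewrite mulr_ge0 // ltW.
  have t01 : 0 <= u / a <= 1.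
    by rewrite divr_ge0 ?ler_pdivrMr ?mul1r //=; lra.
  have yE : y = u / a * (a / (wgt p j)%:R) by rewrite /u; field; rewrite a0 wN0.
  have Cl : C (spoke j (u / a) y).
    rewrite (_ : spoke _ _ _ = (u / a) *: spoke j 1 (a / (wgt p j)%:R)
        + (1 - u / a) *: spoke j 0 (0 / (wgt p j)%:R)).
      apply: cC2 => //.
        by have := Cv j (1, (2 * p).-1%:R); rewrite /= rmorph1 rmorph_nat;
          apply; rewrite !inE eqxx ?orbT.
      by have := Cv j (0, 0); rewrite /= rmorph0;
          apply; rewrite !inE eqxx ?orbT.
    by apply/rowP => i; rewrite !mxE {1}yE; ring.
  have Cr : C (spoke j (a + 2 - u) y).
    rewrite (_ : spoke _ _ _ = (u / a) *: spoke j 2 (a / (wgt p j)%:R)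
        + (1 - u / a) *: spoke j (2 * p).+1%:R (0 / (wgt p j)%:R)).
      apply: cC2 => //.
        by have := Cv j (2, (2 * p).-1%:R); rewrite /= !rmorph_nat;
          apply; rewrite !inE eqxx ?orbT.
      by have := Cv j ((2 * p).+1%:R, 0); rewrite /= rmorph_nat rmorph0;
          apply; rewrite !inE eqxx ?orbT.
    by apply/rowP => i; rewrite !mxE {1}yE aE; field; rewrite a0 wN0.
  have uax : u / a <= x by rewrite ler_pdivrMr 1?mulrC //; lra.
  have [_ ua1] := andP t01.
  set l := u / a in Cl uax ua1.
  (* The chord has length at least 1, as [u <= a] and [l <= 1]. *)
  have d0 : 0 < a + 2 - u - l by lra.
  rewrite (_ : spoke j x y = ((a + 2 - u - x) / (a + 2 - u - l)) *: spoke j l y +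
     (1 - (a + 2 - u - x) / (a + 2 - u - l)) *: spoke j (a + 2 - u) y).
    apply: cC2 => //; rewrite divr_ge0 ?ler_pdivrMr ?mul1r //=; lra.
  by apply/rowP => i; rewrite !mxE; field; rewrite gt_eqF.
have s0 : 0 <= wsum p v by apply: sumr_ge0 => j _; rewrite mulr_ge0.
rewrite -/a mulr1 in v2 v3; rewrite aE mulr1 in v4.
(* If the weighted sum is 0, the shares used as coefficients below do not add up to 1; but then all
   [w_j] vanish and [v] lies on axis [ord0]. *)
have [sE|sN0] := eqVneq (wsum p v) 0.
  rewrite (_ : v = spoke ord0 (v 0 ord0) 0).
    by apply: Cspoke; rewrite ?mulr0 -?sE //; lra.
  apply/rowP => i; case: (unliftP ord0 i) => [j|] ->; last by rewrite spoke0.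
  rewrite spokeS mul0rn; apply/eqP.
  move/eqP: sE; rewrite psumr_eq0 => [/allP/(_ j)|l _]; last by rewrite mulr_ge0.
  by rewrite mem_index_enum => /(_ isT); rewrite /= mulf_eq0 (negPf (wN0 _)).
rewrite (_ : v = \sum_j ((wgt p j)%:R * v 0 (lift ord0 j) / wsum p v) *:
    spoke j (v 0 ord0) (wsum p v / (wgt p j)%:R)).
  apply: convex_sum => // [j||j].
  - by rewrite divr_ge0 // mulr_ge0.
  - by rewrite -mulr_suml divff.
  - by apply: Cspoke; rewrite ?divr_ge0 // mulrC divfK //.
apply/rowP => i; rewrite summxE.
case: (unliftP ord0 i) => [j|] ->.
  rewrite (bigD1 j) //= mxE spokeS eqxx mulr1n big1 ?addr0 => [|l /negPf lj].
    by field; rewrite sN0 wN0.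
  by rewrite mxE spokeS eq_sym lj mulr0.
under eq_bigr do rewrite mxE spoke0.
by rewrite -!mulr_suml divff // mul1r.
Qed.

(** * Ehrhart coefficients and their periods *)

Lemma card_trapezoid_lattice (R : realType) (p r k : nat) :
  (0 < p)%N -> (0 < k)%N ->
  dilate k (@trapezoid R p r 1) `&` @integer_lattice R r.+2
    #= `I_(trapezoidCount p r k).
Proof.
move=> p0 k0; rewrite dilate_trapezoid // trapezoid_lattice //.
apply: card_eq_trans (inj_card_eq _) _.
  by move=> ? ? _ _; exact: nat_point_inj.
by rewrite -trapezoidCountE //; exact: card_finpred.
Qed.

Lemma minimum_period_cst (a : rat) : minimum_period (fun=> a) 1.
Proof. by split. Qed.

(** The coefficients are those of [Q], with a periodic function [g] added in degree 1. Since [2p-1]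
    is [-1] modulo [p], [g (- N)] equals [psi N], and [g] inherits the minimal period of [psi]. *)
Lemma trapezoid_period_sequence (R : realType) (p r : nat) : (0 < p)%N ->
  has_period_sequence (@trapezoid R p r 1)
    (fun i : 'I_r.+3 => if nat_of_ord i == 1%N then p else 1%N).
Proof.
move=> p0; have [Q [psi [sQ psiP LE psimin]]] := trapezoidCount_quasipoly r p0.
have psiM N : psi (N %% p)%N = psi N.
  rewrite [in RHS](divn_eq N p) addnC; elim: (N %/ p)%N => [|m IHm].
    by rewrite addn0.
  by rewrite mulSn addnCA addnC psiP.
(* [psi] lives on [nat]; reduction modulo [p] extends its values at multiples of [2p-1] to all
   integers [z]. *)
pose g (z : int) : rat := psi (absz (((2 * p).-1%:Z * z) %% p)%Z).
have gN N : g (- N%:Z) = psi N.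
  rewrite /g (_ : _ * _ = (- 2 * N%:Z) * p%:Z + N%:Z); last by lia.
  by rewrite modzMDl modz_nat absz_nat psiM.
have gP : periodic g p%:Z.
  by move=> z; rewrite /g mulrDr addrC modzMDl.
have gmin q : (0 < q)%N -> periodic g q%:Z -> (p <= q)%N.
  move=> q0 gq; apply: psimin => // N.
  by rewrite -!gN -(gq (- (N + q)%N%:Z)); congr g; lia.
pose c (i : 'I_r.+3) (z : int) : rat := Q`_i + (if i == 1%N :> nat then g z else 0).
have cP i : minimum_period (c i) (if i == 1%N :> nat then p else 1%N).
  rewrite /c; case: ifP => _; last exact: minimum_period_cst.
  split=> // [z|q q0 cq]; first by rewrite gP.
  by apply: gmin => // z; apply: (addrI Q`_i); exact: cq.
exists c => //; split=> [i|k k0].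
  by have [? ? _] := cP i; exists (if i == 1%N :> nat then p else 1%N).
exists (trapezoidCount p r k); first exact: card_trapezoid_lattice.
rewrite LE (horner_coef_wide _ sQ) /c.
under [RHS]eq_bigr do rewrite mulrDl.
rewrite big_split /=; congr (_ + _).
rewrite (bigD1 (inord 1)) //= inordK // eqxx expr1 big1 ?addr0 => [|i i1].
  by rewrite /g -PoszM modz_nat absz_nat psiM.
case: eqP => [iE|_]; last by rewrite mul0r.
by case/eqP: i1; apply/val_inj; rewrite /= inordK.
Qed.

Theorem theorem1p3 (R : realType) (n p : nat) (hn : (2 <= n)%N)
    (hp : (0 < p)%N) :
  exists P : set 'rV[R]_n,
    [/\ rational_polytope P, has_dimension P n &
        has_period_sequence P
          (fun i : 'I_n.+1 => if nat_of_ord i == 1%N then p else 1%N)].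
Proof.
case: n hn => [|[|r]] // _; exists (trapezoid p 1); split.
- exact: trapezoid_polytope.
- exact: trapezoid_dimension.
- exact: trapezoid_period_sequence.
Qed.
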